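(* Assume that $\mathrm{MA(countable)}$ holds. Then there exists a $\mathrm{P}$-point $\mathcal{U}\subseteq 2^\omega$ that is completely Baire.
   Context: Every subset of $\omega$ is identified with its characteristic function, so an ultrafilter on $\omega$ is regarded as a subset of the Cantor set $2^\omega$ and carries the subspace topology. For $x,y\subseteq\omega$, $x\subseteq^\ast y$ means that $x\setminus y$ is finite; a pseudointersection of $\mathcal{C}\subseteq\mathcal{P}(\omega)$ is a set $x\subseteq\omega$ such that $x\subseteq^\ast y$ for all $y\in\mathcal{C}$. A $\mathrm{P}$-point is a non-principal ultrafilter $\mathcal{U}$ on $\omega$ such that every countable $\mathcal{C}\subseteq\mathcal{U}$ has a pseudointersection in $\mathcal{U}$. A (separable metrizable) space $X$ is completely Baire if every closed subspace of $X$ is a Baire space. $\mathrm{MA(countable)}$ (Martin's Axiom for countable posets) is the statement: for every non-empty countable partially ordered set $\mathbb{P}$ and every collection $\mathcal{D}$ of dense subsets of $\mathbb{P}$ with $|\mathcal{D}|<\mathfrak{c}=2^{\aleph_0}$, there is a filter $G\subseteq\mathbb{P}$ that meets every element of $\mathcal{D}$. *)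

(* Defs.v *)
From mathcomp Require Import all_boot all_order.
From mathcomp Require Import boolp classical_sets functions cardinality filter.
From mathcomp Require Import topology cantor.

Set Implicit Arguments.
Unset Strict Implicit.
Unset Printing Implicit Defensive.

Local Open Scope classical_set_scope.
Local Open Scope card_scope.

Definition card_lt (T U : Type) (A : set T) (B : set U) : Prop :=
  A #<= B /\ ~ (A #= B).

Section Forcing.
Context (d : Order.disp_t) (P : porderType d).
Local Open Scope order_scope.

(* The order-theoretic [dense]; not the topological notion of the library. *)
Definition poset_dense (D : set P) : Prop :=
  forall p : P, exists2 q : P, D q & q <= p.

Definition poset_filter (G : set P) : Prop :=
  [/\ G !=set0,
      forall p q : P, G p -> p <= q -> G q &
      forall p q : P, G p -> G q -> exists r : P, [/\ G r, r <= p & r <= q]].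

End Forcing.

(* [[set: set nat]] is the powerset of omega, so its cardinal is the
   continuum. *)
Definition MA_countable : Prop :=
  forall (d : Order.disp_t) (P : porderType d),
    [set: P] !=set0 -> countable [set: P] ->
    forall Ds : set (set P),
      (forall D, Ds D -> poset_dense D) ->
      card_lt Ds [set: set nat] ->
      exists2 G : set P, poset_filter G & forall D, Ds D -> G `&` D !=set0.

Definition almost_subset (x y : set nat) : Prop := finite_set (x `\` y).

Definition pseudointersection (C : set_system nat) (x : set nat) : Prop :=
  forall y, C y -> almost_subset x y.

Definition nonprincipal_ultrafilter (U : set_system nat) : Prop :=
  UltraFilter U /\ forall n : nat, U <> principal_filter n.

Definition P_point (U : set_system nat) : Prop :=
  nonprincipal_ultrafilter U /\
  forall C : set_system nat, C `<=` U -> countable C ->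
    exists2 x : set nat, U x & pseudointersection C x.

Definition char_fun (x : set nat) : cantor_space := fun n => n \in x.

Definition in_cantor (U : set_system nat) : set cantor_space := char_fun @` U.

Definition baire_space (X : topologicalType) : Prop :=
  forall O : nat -> set X,
    (forall n, open (O n) /\ dense (O n)) -> dense (\bigcap_n O n).

(* [set_type A] is the subtype of points of [A] with the subspace topology
   (unlike [subspace A], which keeps the points outside of [A]). *)
Definition completely_baire (X : topologicalType) : Prop :=
  forall C : set X, closed C -> baire_space (set_type C).

(* Main.v *)
Require Import Defs.
From mathcomp Require Import all_boot all_order.
From mathcomp Require Import boolp classical_sets functions cardinality filter.
From mathcomp Require Import topology cantor.
From HB Require Import structures.
From mathcomp Require Import wochoice.

(** The theorem splits into two independent facts.

    First, every P-point [U] is completely Baire ([P_point_completely_baire]),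
    without any extra axiom.  Let [C] be closed in [U], with dense open
    subsets [O n] of [C].  Build a countable tree of points of [C] indexed by
    [seq nat]: the children of a node [q] agree with [q] on longer and longer
    initial segments and lie in the next [O n].  All nodes belong to [U], so a
    single [a] in [U] is almost contained in every node.  Following a branch,
    a node may be kept for as long as we like; while it is kept, beyond some
    point, the limit contains [a], and the only damage is done between the
    moment when a new node is chosen and the moment when that node starts to
    contain [a].  Run two branches at once, with cut points
    [k 0 < k 1 < ...]: the first one changes its node at the odd cut points,
    the second one at the even cut points, each [k j] being large enough for
    the newest node to have settled.  On every interval [k j, k j.+1) one of
    the two limits contains the whole part of [a] there, so the union of the
    two limits contains [a] minus a finite set, and the ultrafilter contains
    one of them.  That limit is in [C] and in every [O n].

    Second, MA(countable) gives a P-point ([MA_P_point]).  A task is a sequence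
    [y : nat -> set nat]; it is settled by a set [w] that is either a
    pseudointersection of [y] or disjoint from a finite intersection of the
    [y n].  A family [S] with infinite finite intersections that contains, for
    each task, a set settling it generates a P-point
    ([P_point_of_settling]): constant tasks make the filter maximal, and
    tasks enumerating countable subfamilies make it a P-point.  Such an [S] is
    built by transfinite recursion over the tasks, well-ordered so that every
    initial segment has fewer elements than the continuum.  At each stage either
    the family forces some finite intersection of [y] to be small, and then
    its complement can be added, or a Cohen-generic sequence [h], cut down to
    the values [h i] in the intersection of the [y j] for [j <= i], enumerates
    a pseudointersection compatible with the family ([settle]).  There is one
    dense set for each finite subset of the family built so far and each lower
    bound, so one needs that the finite sequences over an infinite initial
    segment are no more numerous than the segment itself; this reduces to the
    equality of an infinite well-ordered cardinal with its square
    ([card_square_below]). *)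

Set Implicit Arguments.
Unset Strict Implicit.
Unset Printing Implicit Defensive.

Local Open Scope classical_set_scope.
Local Open Scope card_scope.

(** * Cardinality of finite sequences over initial segments *)

(** Well-orders are strict and valued in [Prop]: their well-foundedness is
    what transfinite recursion consumes. *)
Definition strict_wo (T : Type) (lt : T -> T -> Prop) : Prop :=
  [/\ well_founded lt,
      forall x y z, lt x y -> lt y z -> lt x z &
      forall x y, [\/ lt x y, x = y | lt y x]].

Definition below (T : Type) (lt : T -> T -> Prop) (x : T) : set T :=
  [set y | lt y x].

Lemma wf_minimal (T : Type) (lt : T -> T -> Prop) (A : set T) :
  well_founded lt -> A !=set0 -> exists2 x, A x & forall y, lt y x -> ~ A y.
Proof.
move=> wf [a Aa]; apply: contrapT => nomin; move: Aa.
elim/(well_founded_ind wf): a => a IH Aa.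
by apply: nomin; exists a.
Qed.

(** The strict part of a reflexive well-order given by the well-ordering
    principle; totality, antisymmetry and transitivity come from minima of sets
    with at most three elements. *)
Lemma exists_strict_wo (T : eqType) : exists lt : T -> T -> Prop, strict_wo lt.
Proof.
have [R woR] := well_ordering_principle T.
have minR (A : {pred T}) x : x \in A ->
    exists2 m, m \in A & forall y, y \in A -> R m y.
  by move=> Ax; have [|m [[Am lbm] _]] := woR A; [exists x | exists m].
have total x y : R x y || R y x.
  have [] := minR (pred2 x y) x; first by rewrite inE eqxx.
  move=> m /pred2P[]-> /(_ _)/[dup] mx my.
    by rewrite mx ?inE ?eqxx ?orbT.
  by rewrite orbC mx ?inE ?eqxx ?orbT.
have anti x y : R x y -> R y x -> x = y.
  move=> Rxy Ryx; have [|m [_ um]] := woR (pred2 x y).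
    by exists x; rewrite inE eqxx.
  have Rr z : R z z by have := total z z; rewrite orbb.
  rewrite -(um x) ?(um y) //; split=> [|z /pred2P[]->] //;
    by rewrite inE eqxx ?orbT.
exists (fun x y => R x y /\ x <> y); split.
- move=> a; apply: contrapT => na.
  pose A : {pred T} := [pred x | ~~ `[< Acc (fun x y => R x y /\ x <> y) x >]].
  have [|m mA minm] := minR A a; first by rewrite inE; apply/asboolPn.
  move: mA; rewrite inE => /asboolPn; apply; constructor => y [Rym ym].
  apply: contrapT => nay; apply: ym; apply: anti => //; apply: minm.
  by rewrite inE; apply/asboolPn.
- move=> x y z [Rxy xy] [Ryz yz]; split; last first.
    by move=> xz; move: Ryz yz; rewrite -xz => Ryx []; apply: anti.
  have [|m] := minR [pred t | [|| t == x, t == y | t == z]] x.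
    by rewrite inE eqxx.
  rewrite inE => /or3P[] /eqP-> minm.
  + by apply: minm; rewrite inE eqxx !orbT.
  + by case: xy; apply: anti => //; apply: minm; rewrite inE eqxx.
  + by case: yz; apply: anti => //; apply: minm; rewrite inE eqxx orbT.
- move=> x y; have [->|/eqP xy] := eqVneq x y; first by constructor 2.
  have /orP[Rxy|Ryx] := total x y; first by constructor 1.
  by constructor 3; split => // /esym.
Qed.

Lemma card_le_injP (T : Type) (U : pointedType) (A : set T) (B : set U) :
  A #<= B <-> exists2 f : T -> U, set_fun A B f & set_inj A f.
Proof. by rewrite -injfunPex; split=> [/pcard_leP|/pcard_leP]. Qed.

(** If some initial segment is as large as [T], an injection of [T] into the
    least such segment carries the order back to [T]; the segments of the new
    order embed in segments of the old one that lie below the least large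
    one. *)
Lemma exists_initial_wo (T : pointedType) :
  exists2 lt : T -> T -> Prop, strict_wo lt &
    forall x, ~ ([set: T] #<= below lt x).
Proof.
have [lt [wf tr tot]] := exists_strict_wo T.
have [/(wf_minimal wf)|none] :=
  pselect ([set x | [set: T] #<= below lt x] !=set0); last first.
  by exists lt => // x Tx; apply: none; exists x.
move=> [a /card_le_injP[g gfun ginj] amin].
have {}ginj x y : g x = g y -> x = y by apply: ginj; rewrite inE.
exists (fun x y => lt (g x) (g y)).
  split=> [x|x y z|x y]; last 1 first.
  - by have [?|/ginj ?|?] := tot (g x) (g y);
      [constructor 1|constructor 2|constructor 3].
  - have acc c : forall y, g y = c -> Acc (fun x y => lt (g x) (g y)) y.
      elim/(well_founded_ind wf): c => c IH y gy; constructor => z.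
      by rewrite gy => /IH; apply.
    exact: (acc (g x)).
  - exact: tr.
move=> x Tx; apply: (amin (g x)); first exact: gfun.
apply: (card_le_trans Tx); apply/card_le_injP; exists g => // y z _ _.
exact: ginj.
Qed.

(** Recursion in which each value depends only on the set of earlier values,
    which is all that the constructions below look at. *)
Lemma wf_rec (T V : Type) (lt : T -> T -> Prop) (Phi : T -> set V -> V) :
  well_founded lt ->
  exists f : T -> V, forall x, f x = Phi x (f @` below lt x).
Proof.
move=> wf.
pose F x (rec : forall y, lt y x -> V) :=
  Phi x [set v | exists y, exists h : lt y x, rec y h = v].
exists (Fix wf (fun=> V) F) => x; rewrite Fix_eq.
  congr Phi; apply/seteqP; split=> v /=; first by move=> [y [h <-]]; exists y.
  by move=> [y h <-]; exists y, h.
move=> y f g fg; congr F; apply: functional_extensionality_dep => z.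
by apply: funext => h.
Qed.

(** Send each point of [E], in the order [R], to a point of [D] that is not yet
    taken: one is left as long as the predecessors are too few to exhaust
    [D]. *)
Lemma card_le_wf (X : Type) (T : pointedType) (R : X -> X -> Prop)
    (E : set X) (D : set T) :
  well_founded R ->
  (forall p q, E p -> E q -> [\/ R p q, p = q | R q p]) ->
  (forall p, E p -> ~ (D #<= below R p)) ->
  E #<= D.
Proof.
move=> wf tot small.
have [f fE] := wf_rec (fun _ S => get (D `\` S)) wf.
have new p : E p -> (D `\` f @` below R p) (f p).
  move=> Ep; rewrite fE; apply: getPex; apply: contrapT => full.
  apply: (small _ Ep); apply: card_le_trans (card_image_le f _).
  apply: subset_card_le => d Dd; apply: contrapT => nd.
  by apply: full; exists d.
apply/card_le_injP; exists f => [p /new[]//|p q /set_mem Ep /set_mem Eq fpq].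
have [Rpq|//|Rqp] := tot _ _ Ep Eq.
  by have [_ []] := new _ Eq; exists p.
by have [_ []] := new _ Ep; exists q.
Qed.

Lemma card_le_setX (T U : pointedType) (A : set T) (B : set U) :
  A #<= B -> A `*` A #<= B `*` B.
Proof.
move=> /card_le_injP[f fAB finj]; apply/card_le_injP.
exists (fun p => (f p.1, f p.2)) => [p [/= ? ?]|[a b] [c d]].
  by split; apply: fAB.
rewrite !inE => -[/= Aa Ab] [/= Ac Ad] [/finj eac /finj ebd].
by congr (_, _); [apply: eac|apply: ebd]; rewrite inE.
Qed.

Lemma card_le_setU1 (T : pointedType) (A : set T) (x : T) :
  infinite_set A -> A `|` [set x] #<= A `*` A.
Proof.
move=> Ainf; have [a Aa] := infinite_setN0 Ainf.
have [b [Ab ba]] : (A `\` [set a]) !=set0.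
  by apply: infinite_setN0; apply: infinite_setD (finite_set1 a).
apply/card_le_injP; exists (fun y => if pselect (A y) then (a, y) else (b, b)).
  by move=> y _; case: pselect => // ?; split.
have out y : (A `|` [set x]) y -> ~ A y -> y = x by move=> [].
move=> y z; rewrite !inE => Ay Az.
case: pselect => hy; case: pselect => hz.
- by case.
- by case=> /esym.
- by case.
- by move=> _; rewrite [LHS]out ?[RHS]out.
Qed.

(** Hessenberg's argument.  Order pairs by their maximum [mu], breaking ties by
    an arbitrary well-order.  The predecessors of a pair lie in the square of
    the closed segment up to its maximum.  This square is finite or, by
    hypothesis, no larger than the segment strictly below the maximum.  So if
    [D] embedded in such a set of predecessors, it would embed in one of its
    proper segments, and the bound on the square of that segment would pass
    to [D]. *)
Lemma square_step (T : pointedType) (lt : T -> T -> Prop) (D : set T) :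
  strict_wo lt -> (forall x y, D x -> lt y x -> D y) -> infinite_set D ->
  (forall x, D x -> infinite_set (below lt x) ->
     below lt x `*` below lt x #<= below lt x) ->
  D `*` D #<= D.
Proof.
move=> wo down Dinf sq; apply: contrapT => nD.
have small x : D x -> ~ (D #<= below lt x).
  move=> Dx Dle.
  have binf : infinite_set (below lt x) by move=> /(card_le_finite Dle).
  apply: nD; apply: (card_le_trans (card_le_setX Dle)).
  apply: (card_le_trans (sq _ Dx binf)).
  by apply: subset_card_le => y /(down _ _ Dx).
have [W [wfW _ totW]] := exists_strict_wo (T * T)%type.
have [wf tr tot] := wo.
pose mu (p : T * T) := if pselect (lt p.1 p.2) then p.2 else p.1.
pose R p q := lt (mu p) (mu q) \/ mu p = mu q /\ W p q.
apply: nD; apply: (card_le_wf (R := R)).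
- have acc a : forall p, mu p = a -> Acc R p.
    elim/(well_founded_ind wf): a => a IHa p.
    elim/(well_founded_ind wfW): p => p IHp mp.
    constructor=> q [lqp|[eqp Wqp]]; last by apply: IHp => //; rewrite eqp.
    by apply: (IHa (mu q)) => //; rewrite -mp.
  by move=> p; apply: (acc (mu p)).
- move=> p q _ _; have [?|mpq|?] := tot (mu p) (mu q).
  + by constructor 1; left.
  + by have [?|->|?] := totW p q;
      [constructor 1; right|constructor 2|constructor 3; right].
  + by constructor 3; left.
move=> p [Dp1 Dp2] Dle.
have Dm : D (mu p) by rewrite /mu; case: pselect.
set S := below lt (mu p) `|` [set mu p].
have SR : below R p `<=` S `*` S.
  have S_mu q y : R q p -> y = mu q \/ lt y (mu q) -> S y.
    by move=> [lqp|[-> _]] [->|ly]; [left|left; apply: tr ly lqp|right|left].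
  move=> q Rqp; split; apply: (S_mu q) => //; rewrite /mu; case: pselect; auto.
  by have [| ->|] := tot q.1 q.2; auto.
have {}Dle := card_le_trans Dle (subset_card_le SR).
have Sinf : infinite_set S.
  move=> Sfin; apply: Dinf.
  exact: card_le_finite Dle (finite_setX Sfin Sfin).
have binf : infinite_set (below lt (mu p)).
  move=> bfin; apply: Sinf; rewrite finite_setU.
  by split; [|apply: finite_set1].
apply: (small _ Dm); apply: (card_le_trans Dle).
have sqm := sq _ Dm binf.
apply: (card_le_trans _ sqm); apply: card_le_setX.
exact: card_le_trans (card_le_setU1 _ binf) sqm.
Qed.

Lemma card_square_below (T : pointedType) (lt : T -> T -> Prop) (x : T) :
  strict_wo lt -> infinite_set (below lt x) ->
  below lt x `*` below lt x #<= below lt x.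
Proof.
move=> wo; have [wf tr _] := wo.
elim/(well_founded_ind wf): x => x IH xinf.
apply: (square_step wo) => // y z yx zy; exact: tr zy yx.
Qed.

(** Sequences of equal length are coded by iterating a pairing function of [A];
    the length and the extra number are stored in a copy of [nat] inside
    [A]. *)
Lemma card_seq_le (T : pointedType) (A : set T) :
  infinite_set A -> A `*` A #<= A ->
  [set p : seq T * nat | [set` p.1] `<=` A] #<= A.
Proof.
move=> /infiniteP/card_le_injP[u uA uinj] /card_le_injP[c cA cinj].
have {}uinj m n : u m = u n -> m = n by apply: uinj; rewrite inE.
have {}cinj a b a' b' : A a -> A b -> A a' -> A b' ->
    c (a, b) = c (a', b') -> a = a' /\ b = b'.
  move=> Aa Ab Aa' Ab' e.
  by have [-> ->] := cinj (a, b) (a', b')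
    (mem_set (conj Aa Ab)) (mem_set (conj Aa' Ab')) e.
have {}cA a b : A a -> A b -> A (c (a, b)) by move=> Aa Ab; apply: cA.
have {}uA n : A (u n) by apply: uA.
pose code := foldr (fun x y => c (x, y)) (u 0%N).
have codeA s : [set` s] `<=` A -> A (code s).
  elim: s => [|x s IH] sA //=; apply: cA.
    by apply: sA; rewrite /= mem_head.
  by apply: IH => y ys; apply: sA; rewrite /= inE ys orbT.
have code_inj s t : size s = size t -> [set` s] `<=` A -> [set` t] `<=` A ->
    code s = code t -> s = t.
  elim: s t => [|x s IH] [|y t] //= [st] sA tA.
  have sA' : [set` s] `<=` A by move=> z zs; apply: sA; rewrite /= inE zs orbT.
  have tA' : [set` t] `<=` A by move=> z zs; apply: tA; rewrite /= inE zs orbT.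
  move=> /cinj[]; try exact: codeA.
  - by apply: sA; rewrite /= mem_head.
  - by apply: tA; rewrite /= mem_head.
  - by move=> -> /IH ->.
apply/card_le_injP; exists (fun p => c (u p.2, c (u (size p.1), code p.1))).
  move=> [s n] /= sA; do 2!apply: (cA _ _ (uA _)).
  exact: codeA.
move=> [s m] [t n]; rewrite !inE /= => sA tA.
have As := codeA _ sA; have At := codeA _ tA.
move=> /cinj[]; try by do ?apply: cA.
by move=> /uinj-> /cinj[] // /uinj/code_inj st /st->.
Qed.

(** * P-points are completely Baire *)

Definition agree (m : nat) (x y : set nat) : Prop :=
  forall i, (i < m)%N -> (x i <-> y i).

Lemma agreeW m n x y : (m <= n)%N -> agree n x y -> agree m x y.
Proof. by move=> mn xy i im; apply: xy; apply: leq_trans im mn. Qed.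

Lemma agree_sym m x y : agree m x y -> agree m y x.
Proof. by move=> xy i /xy ->. Qed.

Lemma agree_trans m x y z : agree m x y -> agree m y z -> agree m x z.
Proof. by move=> xy yz i im; rewrite xy // yz. Qed.

(** Coordinate [i] is frozen from [x i] on, because [i < k i]; the limit is
    therefore the diagonal. *)
Lemma agree_limit (x : nat -> set nat) (k : nat -> nat) :
  (forall l, (l < k l)%N) -> (forall l, (k l <= k l.+1)%N) ->
  (forall l, agree (k l) (x l) (x l.+1)) ->
  exists y : set nat, forall l, agree (k l) y (x l).
Proof.
move=> lk kS xS.
have kmono l d : (k l <= k (l + d))%N.
  by elim: d => [|d IH]; rewrite ?addn0 // addnS (leq_trans IH).
have xd l d : agree (k l) (x l) (x (l + d)).
  elim: d => [|d IH]; first by rewrite addn0.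
  rewrite addnS; apply: agree_trans IH _; exact: agreeW (kmono l d) (xS _).
exists (fun i => x i i) => l i ikl.
have [il|/ltnW li] := leqP i l.
  have := xd i (l - i) i (lk i); rewrite subnKC //.
by have := xd l (i - l) i ikl; rewrite subnKC // => ->.
Qed.

Lemma finite_set_nat_bound (A : set nat) :
  finite_set A -> exists m, forall i, A i -> (i < m)%N.
Proof.
move=> /finite_seqP[s ->]; exists (foldr maxn 0 s).+1 => i /=.
elim: s => // x s IH; rewrite inE /= !ltnS leq_max => /orP[/eqP->|/IH].
  by rewrite leqnn.
rewrite ltnS => ->; exact: orbT.
Qed.

(** An ultrafilter containing a singleton is principal, so all singletons can
    be removed one after the other. *)
Lemma nonprincipal_tail (U : set_system nat) (k : nat) :
  nonprincipal_ultrafilter U -> U [set i | (k <= i)%N].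
Proof.
move=> [UU nonpr]; have UF : Filter U by typeclasses eauto.
elim: k => [|k IH]; first by apply: filterS filterT.
have [Uk|Uk] := in_ultra_setVsetC [set k] UU.
  exfalso; apply: (nonpr k).
  have := @max_filter _ _ (principal_filter_ultra k) U; apply => //.
  by move=> A /principal_filterP Ak; apply: filterS Uk => _ ->.
apply: filterS (filterI IH Uk) => i [/= ki ik].
by rewrite ltn_neqAle ki andbT; apply/eqP => /esym.
Qed.

(** The combinatorial heart of complete Baireness, free of topology: [Q] is a
    space whose points [q] are the sets [tr q] of [U], with the topology given
    by agreement on initial segments.  The hypotheses say that [Q] is closed
    in [U] and that the [O n] are open and dense. *)
Lemma P_point_fusion (U : set_system nat) (Q : Type) (tr : Q -> set nat)
    (O : nat -> set Q) :
  P_point U ->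
  (forall q, U (tr q)) ->
  (forall x, U x -> (forall m, exists q, agree m x (tr q)) ->
     exists q, tr q = x) ->
  (forall n q, O n q ->
     exists m, forall q', agree m (tr q) (tr q') -> O n q') ->
  (forall n q m, exists2 q', agree m (tr q) (tr q') & O n q') ->
  forall q0 m0, exists2 q, agree m0 (tr q0) (tr q) & forall n, O n q.
Proof.
move=> [Unp Upp] Utr Qclosed Oopen Odense q0 m0.
have [UU _] := Unp; have UF : Filter U by typeclasses eauto.
pose next n q m := projT1 (cid2 (Odense n q m)).
have next_agree n q m : agree m (tr q) (tr (next n q m)).
  by rewrite /next; case: cid2.
have nextO n q m : O n (next n q m) by rewrite /next; case: cid2.
pose node := fix node s :=
  if s is m :: s' then next (size s') (node s') m else q0.
have [a Ua pa] : exists2 a, U a & forall s, finite_set (a `\` tr (node s)).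
  have [||a Ua pa] := Upp (range (tr \o node)).
  - by move=> _ [s _ <-]; apply: Utr.
  - apply: card_le_trans (card_image_le _ _) _; exact: countableP.
  - by exists a => // s; apply: pa; exists s.
(* Beyond [b s] the node of [s] contains [a], and agreement with it below
   [b s] guarantees membership in the dense open set of its level. *)
have /choice[b bP] : forall s, exists m,
    (forall i, (m <= i)%N -> a i -> tr (node s) i) /\
    (forall n q, size s = n.+1 -> agree m (tr (node s)) (tr q) -> O n q).
  move=> s; have [m1 m1P] := finite_set_nat_bound (pa s).
  have [m2 m2P] : exists m, forall n q, size s = n.+1 ->
      agree m (tr (node s)) (tr q) -> O n q.
    case: s {m1P} => [|m s]; first by exists 0.
    have [m2 m2P] := Oopen _ _ (nextO (size s) (node s) m).
    by exists m2 => n q /= [<-]; apply: m2P.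
  exists (maxn m1 m2); split=> [i|n q sn].
    rewrite geq_max => /andP[m1i _] ai; apply: contrapT => ni.
    by have := m1P i (conj ai ni); rewrite ltnNge m1i.
  move=> ag; apply: (m2P _ _ sn); exact: agreeW (leq_maxr _ _) ag.
(* The state is the current cut point and the two branches; the branch that
   was extended at a step waits during the next one, hence the swap. *)
pose run := fix run j := if j is j'.+1 then
    let: (k, s, t) := run j' in (maxn k.+1 (b (k :: s)), t, k :: s)
  else (maxn m0 (b [::]), [::], [::]).
pose k j := (run j).1.1; pose t j := (run j).2.
have tSS j : t j.+2 = k j.+1 :: t j.
  by rewrite /t /k /=; case: (run j) => [[k' s'] t'].
have kS j : (k j < k j.+1)%N.
  by rewrite /k /=; case: (run j) => [[k' s'] t'] /=; rewrite leq_maxl.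
have bk j : (b (t j) <= k j)%N.
  case: j => [|j]; first by rewrite leq_maxr.
  by rewrite /k /t /=; case: (run j) => [[k' s'] t'] /=; rewrite leq_maxr.
have jk j : (j <= k j)%N.
  by elim: j => // j IH; apply: leq_ltn_trans IH (kS j).
(* [p] is the parity of the steps at which the branch is current. *)
have lim p : exists x, forall l,
    agree (k (l.*2 + p).+1) x (tr (node (t (l.*2 + p)))).
  apply: (agree_limit (x := fun l => tr (node (t (l.*2 + p))))) => l.
  - apply: leq_trans (jk _); rewrite ltnS -addnn -addnA leq_addr //.
  - by rewrite doubleS !addSn ltnW // (ltn_trans (kS _)) // (ltn_trans (kS _)).
  - by rewrite doubleS !addSn tSS; apply: next_agree.
have [x0 x0P] := lim 0; have [x1 x1P] := lim 1.
have cover : a `&` [set i | (k 0 <= i)%N] `<=` x0 `|` x1.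
  move=> i [ai /= k0i].
  have [j kji ikj] : exists2 j, (k j <= i)%N & (i < k j.+1)%N.
    have ex : exists j, (i < k j)%N by exists i.+1; apply: jk.
    have [[|j] ikj jmin] := ex_minnP ex; first by rewrite ltnNge k0i in ikj.
    exists j => //; rewrite leqNgt; apply/negP => /jmin.
    by rewrite ltnn.
  have aij : tr (node (t j)) i.
    by apply: (bP (t j)).1 => //; apply: leq_trans kji.
  have jE := odd_double_half j; rewrite addnC in jE.
  case: (odd j) jE => /= jE; [right; apply/(x1P j./2)|left; apply/(x0P j./2)];
    by rewrite jE.
have [p [x Ux xP]] : exists p : bool, exists2 x, U x & forall l,
    agree (k (l.*2 + p).+1) x (tr (node (t (l.*2 + p)))).
  have Ux01 : U (x0 `|` x1).
    by apply: filterS cover _; apply: filterI Ua _; apply: nonprincipal_tail.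
  have [Ux0|Ux0] := in_ultra_setVsetC x0 UU; first by exists false, x0.
  exists true, x1 => //; apply: filterS (filterI Ux01 Ux0).
  by move=> i [[x0i|//] /(_ x0i)].
have [|q qx] := Qclosed x Ux.
  move=> m; exists (node (t (m.*2 + p))); apply: agreeW (xP m).
  by apply: leq_trans (jk _); rewrite leqW // -addnn -addnA leq_addr.
(* The branch of parity [p] visits every level. *)
have st j : size (t j.*2) = j /\ size (t j.*2.+1) = j.+1.
  by elim: j => // j [IH1 IH2]; rewrite doubleS !tSS /= IH1 IH2.
exists q => [|n]; first rewrite qx.
  have ax : agree m0 (tr (node (t p))) x.
    apply: agree_sym; apply: agreeW (xP 0).
    apply: (leq_trans (n := k 0)); first exact: leq_maxl.
    by case: (p); rewrite ltnW // (ltn_trans (kS 0)) // kS.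
  apply: agree_trans ax; case: (p) => /=; last by move=> i.
  by apply: agreeW (next_agree 0 q0 (k 0)); rewrite leq_maxl.
apply: (bP (t ((n.+1 - p).*2 + p))).2.
  have [se so] := st (n.+1 - p).
  by case: (p) se so => /= se so; rewrite ?addn0 ?addn1 ?se ?so ?subn0 ?subn1.
rewrite qx; apply: agree_sym; apply: agreeW (xP _).
by apply: leq_trans (bk _) _; rewrite ltnW.
Qed.

Definition cylinder (f : cantor_space) (m : nat) : set cantor_space :=
  [set g | forall i, (i < m)%N -> g i = f i].

Lemma open_cylinder f m : open (cylinder f m).
Proof.
elim: m => [|m IH].
  by rewrite (_ : cylinder f 0 = setT); [exact: openT|apply/seteqP; split].
rewrite (_ : cylinder f m.+1 = cylinder f m `&` (fun g => g m) @^-1` [set f m]).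
  apply: openI => //; apply: open_comp; last exact: discrete_open.
  by move=> g _; apply: (@proj_continuous nat (fun=> bool) m).
apply/seteqP; split=> g.
  by move=> gf; split=> [i im|]; apply: gf => //; exact: ltnW.
by move=> [gf gm] i; rewrite ltnS leq_eqVlt => /orP[/eqP->|/gf].
Qed.

(** The supersets of cylinders around [f] form a filter converging to [f],
    since each coordinate is eventually constant along it. *)
Lemma cylinder_basis (f : cantor_space) (B : set cantor_space) :
  open B -> B f -> exists m, cylinder f m `<=` B.
Proof.
move=> oB Bf.
pose F : set_system cantor_space := [set A | exists m, cylinder f m `<=` A].
have FF : Filter F.
  split; first by exists 0.
    move=> A1 A2 [m1 s1] [m2 s2]; exists (maxn m1 m2) => g gf.
    by split; [apply: s1|apply: s2] => i im; apply: gf;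
      rewrite leq_max im ?orbT.
  by move=> A1 A2 s12 [m s1]; exists m => g /s1/s12.
have Ff : F --> f.
  apply/cvg_sup => i A [V] [[W] oW <-] Wf WA.
  by exists i.+1 => g gf; apply: WA; rewrite /= gf.
by apply: Ff; apply: open_nbhs_nbhs.
Qed.

(** Cylinders translate the twice-relativized product topology of a closed
    subspace into agreement on initial segments. *)
Lemma P_point_completely_baire (U : set_system nat) :
  P_point U -> completely_baire (set_type (in_cantor U)).
Proof.
move=> PU C closedC O OP O' [q0 O'q0] oO'.
pose pt (q : set_type C) : cantor_space := set_val (set_val q).
pose tr q : set nat := [set n | pt q n].
have open_tr (B : set (set_type C)) q : open B -> B q ->
    exists m, forall q', agree m (tr q) (tr q') -> B q'.
  move=> [B1 [B2 oB2 <-] <-] B2q; have [m mB2] := cylinder_basis oB2 B2q.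
  exists m => q' qq'; apply: mB2 => i im; have [h1 h2] := qq' i im.
  by apply/idP/idP; [apply: h2|apply: h1].
have Utr q : U (tr q).
  have [x Ux xq] := set_mem (valP (set_val q)).
  have {}xq : pt q = char_fun x by exact: esym xq.
  by rewrite (_ : tr q = x) // /tr xq; apply/seteqP; split=> n /=;
    [exact: set_mem|exact: mem_set].
have [m0 m0P] := open_tr _ _ oO' O'q0.
have tr_closed x : U x -> (forall m, exists q, agree m x (tr q)) ->
    exists q, tr q = x.
  move=> Ux xC.
  have Ax : in_cantor U (char_fun x) by exists x.
  pose p : set_type (in_cantor U) := SigSub (mem_set Ax).
  have Cp : C p.
    apply: closedC => B.
    rewrite nbhsE => -[B1 [[B2 oB2 <-] B2p] B1B].
    have [m mB2] := cylinder_basis oB2 B2p.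
    have [q xq] := xC m.
    exists (set_val q); split; first exact: set_mem (valP q).
    apply: B1B; apply: mB2 => i im.
    have [h1 h2] := xq i im; apply/idP/idP => [/h2 xi|]; first exact: mem_set.
    by move=> /set_mem /h1.
  exists (SigSub (mem_set Cp)); apply/seteqP; split=> n.
    exact: set_mem.
  exact: mem_set.
have Oopen n q : O n q ->
    exists m, forall q', agree m (tr q) (tr q') -> O n q'.
  by apply: open_tr; have [] := OP n.
have Odense n q m : exists2 q', agree m (tr q) (tr q') & O n q'.
  have [_ dO] := OP n.
  have [||q' [cq' Oq']] := dO (set_val @^-1` (set_val @^-1` cylinder (pt q) m)).
  - by exists q.
  - exists (set_val @^-1` cylinder (pt q) m) => //.
    by exists (cylinder (pt q) m) => //; apply: open_cylinder.
  by exists q' => // i im; rewrite /tr /= -(cq' i im).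
have [q q0q Oq] := P_point_fusion PU Utr tr_closed Oopen Odense q0 m0.
by exists q; split; [apply: m0P|move=> n _; apply: Oq].
Qed.

(** * Cohen forcing *)

(** Cohen forcing: an alias of [seq nat] that can carry the order in which
    extensions are smaller. *)
Definition cohen : Type := seq nat.
HB.instance Definition _ := Choice.on cohen.

Definition cohen_le (t s : cohen) : bool := prefix s t.

Lemma cohen_le_refl : reflexive cohen_le.
Proof. by move=> s; apply: prefix_refl. Qed.

Lemma cohen_le_anti : antisymmetric cohen_le.
Proof.
move=> s t /andP[]; rewrite /cohen_le => /prefixP[u ->] /prefixP[v].
move/(congr1 size)/eqP; rewrite !size_cat -addnA -[X in X == _]addn0 eqn_add2l.
by rewrite eq_sym addn_eq0 => /andP[/nilP-> _]; rewrite cats0.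
Qed.

Lemma cohen_le_trans : transitive cohen_le.
Proof. by move=> t s r st tr; apply: prefix_trans tr st. Qed.

Fact cohen_display : Order.disp_t. Proof. exact: Order.Disp tt tt. Qed.

HB.instance Definition _ := Order.Le_isPOrder.Build cohen_display cohen
  cohen_le_refl cohen_le_anti cohen_le_trans.

(** The conditions in [G] are the initial segments of one generic sequence. *)
Lemma MA_cohen (Ds : set (set (seq nat))) :
  MA_countable -> card_lt Ds [set: set nat] ->
  (forall D, Ds D -> forall s, exists2 t, D t & prefix s t) ->
  exists2 G : set (seq nat),
    forall s t, G s -> G t -> exists r, prefix s r /\ prefix t r &
    forall D, Ds D -> exists2 s, G s & D s.
Proof.
move=> MA small dns.
have [||||G [_ _ Gdir] Gmeet] := MA cohen_display cohen _ _ Ds.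
- by exists [::].
- exact: (countableP [set: seq nat]).
- by move=> D DsD s; have [t Dt st] := dns D DsD s; exists t.
- exact: small.
exists G => [s t Gs Gt|D /Gmeet[s [Gs Ds']]]; last by exists s.
by have [r [_ rs rt]] := Gdir s t Gs Gt; exists r.
Qed.

(** * Settling one task *)

Definition inter (l : seq (set nat)) : set nat :=
  [set m | forall a, a \in l -> a m].

(** Asking for arbitrarily large elements, and not just one, allows the
    cofinite sets to be added to the generated filter. *)
Definition centered (S : set (set nat)) : Prop :=
  forall l, [set` l] `<=` S -> forall k, exists2 m, (k <= m)%N & inter l m.

Definition initial_inter (y : nat -> set nat) (n : nat) : set nat :=
  [set m | forall j, (j <= n)%N -> y j m].

(** The second alternative keeps the sets [y n] from lying all together in a
    proper filter that contains [w]. *)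
Definition settles (w : set nat) (y : nat -> set nat) : Prop :=
  (forall n, almost_subset w (y n)) \/ exists n, w `&` initial_inter y n = set0.

Lemma inter_cat l1 l2 m : inter (l1 ++ l2) m <-> inter l1 m /\ inter l2 m.
Proof.
split=> [h|[h1 h2] a].
  by split=> a al; apply: h; rewrite mem_cat al ?orbT.
by rewrite mem_cat => /orP[/h1|/h2].
Qed.

Lemma centeredU1 (S : set (set nat)) (w : set nat) :
  (forall l, [set` l] `<=` S ->
     forall k, exists2 m, (k <= m)%N & w m /\ inter l m) ->
  centered (w |` S).
Proof.
move=> wS l lS k; have [|m km [wm lm]] := wS [seq a <- l | a != w] _ k.
  by move=> a /=; rewrite mem_filter => /andP[/eqP aw /lS[]].
exists m => // a al; have [->//|aw] := eqVneq a w.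
by apply: lm; rewrite mem_filter aw.
Qed.

(** Accept the value [h i] of the generic sequence [h] when it lies in [y j] for
    all [j <= i].  If the finite intersections of [y] are compatible with [S],
    then for every finite part [l] of [S] and every [k], some accepted value
    that is at least [k] lies in the intersection of [l]; the accepted values
    outside of [y n] occur among the first [n] terms of [h].  Otherwise
    some intersection of the first [y j] meets the intersection of a finite
    part of [S] in a bounded set, and its complement is compatible with
    [S]. *)
Lemma settle (S : set (set nat)) (y : nat -> set nat) :
  MA_countable ->
  card_lt [set p : seq (set nat) * nat | [set` p.1] `<=` S] [set: set nat] ->
  centered S ->
  exists2 w, centered (w |` S) & settles w y.
Proof.
move=> MA small cS; have [pos|neg] := pselect (forall l, [set` l] `<=` S ->
    forall n k, exists2 m, (k <= m)%N & inter l m /\ initial_inter y n m);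
  last first.
  have [l [lS [n [k nm]]]] : exists l, [set` l] `<=` S /\ exists n k, forall m,
      (k <= m)%N -> inter l m -> ~ initial_inter y n m.
    apply: contrapT => h; apply: neg => l lS n k.
    apply: contrapT => nm; apply: h.
    exists l; split=> //; exists n, k => m km lm ym; apply: nm.
    by exists m.
  exists (~` initial_inter y n); last first.
    by right; exists n; rewrite setICl.
  apply: centeredU1 => l' l'S k'.
  have [|m] := cS (l ++ l') _ (maxn k k').
    by move=> a /=; rewrite mem_cat => /orP[/lS|/l'S].
  rewrite geq_max => /andP[km k'm] /inter_cat[lm l'm]; exists m => //.
  by split=> //; apply: nm km lm.
pose hit l k : set (seq nat) := [set s | exists i, [/\ (i < size s)%N,
  (k <= nth 0 s i)%N, inter l (nth 0 s i) & initial_inter y i (nth 0 s i)]].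
pose idx := [set p : seq (set nat) * nat | [set` p.1] `<=` S].
have [||G Gdir Gmeet] := @MA_cohen ((fun p => hit p.1 p.2) @` idx) MA.
- split; first by apply: card_le_trans (card_image_le _ _) small.1.
  move=> /card_eqPle[_ le]; apply: small.2; apply/card_eqPle.
  split; first exact: small.1.
  exact: card_le_trans le (card_image_le _ _).
- move=> _ [[l k] /= lS <-] s.
  have [m km [lm ym]] := pos l lS (size s) k.
  exists (rcons s m); last exact: prefix_rcons.
  by exists (size s); rewrite size_rcons nth_rcons ltnn eqxx.
pose w : set nat := [set m | exists s i,
  [/\ G s, (i < size s)%N, nth 0 s i = m & initial_inter y i m]].
exists w.
  apply: centeredU1 => l lS k.
  have [|s Gs [i [si ki li yi]]] := Gmeet (hit l k); first by exists (l, k).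
  by exists (nth 0 s i) => //; split => //; exists s, i.
left=> n.
(* Accepted values outside of [y n] sit at positions below [n], and each
   position carries only one value, because [G] is directed. *)
suff fin k : finite_set [set m | exists s i, [/\ G s, (i < size s)%N,
    nth 0 s i = m & (i < k)%N]].
  apply: sub_finite_set (fin n) => m [[s [i [Gs si sm ym]]] nym].
  exists s, i; split=> //; rewrite ltnNge; apply/negP => ni.
  by apply: nym; apply: ym.
elim: k => [|k IH].
  by rewrite (_ : [set _ | _] = set0) // -subset0 => m [s [i []]].
have [[s [Gs ks]]|none] := pselect (exists s, G s /\ (k < size s)%N);
  last first.
  apply: sub_finite_set IH => m [s [i [Gs si sm]]].
  rewrite ltnS leq_eqVlt => /orP[/eqP ik|ik]; last by exists s, i.
  by case: none; exists s; rewrite -ik.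
apply: (@sub_finite_set _ _ (_ `|` [set nth 0 s k])); last first.
  by rewrite finite_setU; split; [exact: IH|exact: finite_set1].
move=> m [t [i [Gt ti tm]]].
rewrite ltnS leq_eqVlt => /orP[/eqP ik|ik]; last by left; exists t, i.
right; have [r [/prefixP[u ru] /prefixP[v rv]]] := Gdir _ _ Gs Gt.
rewrite /= -tm ik; have := congr1 (fun r => nth 0 r k) rv.
by rewrite ru !nth_cat ks -ik ti => ->.
Qed.

(** * Counting the dense sets *)

(** Cantor's diagonal argument. *)
Lemma not_card_le_powerset_nat : ~ ([set: set nat] #<= [set: nat]).
Proof.
move=> /card_le_injP[f _ finj].
pose D : set nat := [set n | exists2 A : set nat, f A = n & ~ A n].
have nD : ~ D (f D).
  by move=> /[dup] DfD [A /finj-> //]; rewrite inE.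
by apply: (nD); exists D.
Qed.

Lemma countable_seq (T : eqType) (A : set T) :
  countable A -> countable [set p : seq T * nat | [set` p.1] `<=` A].
Proof.
move=> /countable_injP[f finj].
have map_inj (s t : seq T) : [set` s] `<=` A -> [set` t] `<=` A ->
    map f s = map f t -> s = t.
  elim: s t => [|x s IH] [|y t] //= sA tA [fxy /IH->].
  - by congr (_ :: _); apply: finj => //; apply: mem_set;
      [apply: sA|apply: tA]; rewrite /= mem_head.
  - by move=> z zs; apply: sA; rewrite /= inE zs orbT.
  - by move=> z zs; apply: tA; rewrite /= inE zs orbT.
apply/countable_injP; exists (fun p => pickle (map f p.1, p.2)) => -[s m] [t n].
rewrite !inE /= => sA tA /(pcan_inj pickleK)[/(map_inj _ _ sA tA)-> ->] //.
Qed.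

Lemma card_seq_of_sets : [set: nat -> set nat] #<= [set: set nat].
Proof.
apply/card_le_injP.
pose code (y : nat -> set nat) : set nat :=
  [set i | exists n m, y n m /\ pickle (n, m) = i].
exists code => // y y' _ _ yy'.
suff sub u v : code u = code v -> forall n m, u n m -> v n m.
  by apply: funext => n; apply/seteqP; split=> m; apply: sub.
move=> uv n m unm; have : code u (pickle (n, m)).
  by exists n, m.
by rewrite uv => -[n' [m' [vnm /(pcan_inj pickleK) [<- <-]]]].
Qed.

(** A finite segment has only countably many finite sequences; for an infinite
    one they inject into the segment itself. *)
Lemma card_lt_seq_below (lt : (nat -> set nat) -> (nat -> set nat) -> Prop) x :
  strict_wo lt -> ~ ([set: nat -> set nat] #<= below lt x) ->
  card_lt [set p : seq (nat -> set nat) * nat | [set` p.1] `<=` below lt x]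
    [set: set nat].
Proof.
move=> wo small; have [bfin|binf] := pselect (finite_set (below lt x)).
  have cnt := countable_seq (finite_set_countable bfin).
  split.
    apply: (card_le_trans cnt); apply/card_le_injP.
    by exists (fun n => [set n]) => // m n _ _ /seteqP[/(_ m erefl)].
  move=> /card_eqPle[_ le]; apply: not_card_le_powerset_nat.
  exact: card_le_trans le cnt.
have le := card_seq_le binf (card_square_below wo binf).
split.
  apply: (card_le_trans le); apply: card_le_trans card_seq_of_sets.
  exact: card_leT.
move=> /card_eqPle[_ le']; apply: small.
exact: card_le_trans card_seq_of_sets (card_le_trans le' le).
Qed.

Lemma card_lt_le (T U V : Type) (A : set T) (B : set U) (C : set V) :
  A #<= B -> card_lt B C -> card_lt A C.
Proof.
move=> AB [BC nBC]; split; first exact: card_le_trans AB BC.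
move=> /card_eqPle[_ CA]; apply: nBC; apply/card_eqPle; split=> //.
exact: card_le_trans CA AB.
Qed.

Lemma seq_image (T V : eqType) (z : T -> V) (A : set T) (l : seq V) :
  [set` l] `<=` z @` A -> exists2 l', [set` l'] `<=` A & l = map z l'.
Proof.
elim: l => [|v l IH] lA; first by exists [::].
have [l' l'A ->] : exists2 l', [set` l'] `<=` A & l = map z l'.
  by apply: IH => a al; apply: lA; rewrite /= inE al orbT.
have [|x Ax <-] := lA v; first by rewrite /= mem_head.
by exists (x :: l') => // a; rewrite /= inE => /orP[/eqP->|/l'A].
Qed.

Lemma card_seq_image (T V : eqType) (z : T -> V) (A : set T) :
  [set p : seq V * nat | [set` p.1] `<=` z @` A] #<=
  [set p : seq T * nat | [set` p.1] `<=` A].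
Proof.
apply: card_le_trans (card_image_le (fun p => (map z p.1, p.2)) _).
apply: subset_card_le => -[l k] /= /seq_image[l' l'A ->].
by exists (l', k).
Qed.

(** * The transfinite construction of a P-point *)

(** A finite part of [z @` A] is already contained in the stage of its largest
    index. *)
Lemma centered_chain (T : Type) (lt : T -> T -> Prop) (z : T -> set nat)
    (A : set T) :
  strict_wo lt ->
  (forall x, A x -> centered (z x |` z @` below lt x)) -> centered (z @` A).
Proof.
move=> [_ tr tot] cA l lA k.
have [->|[x Ax lx]] : l = [::] \/
    exists2 x, A x & [set` l] `<=` z x |` z @` below lt x.
  - elim: l lA => [|a l IH] lA; [by left|right].
    have [|x Ax zx] := lA a; first by rewrite /= mem_head.
    have [||[y Ay ly]] := IH.
    + by move=> b bl; apply: lA; rewrite /= inE bl orbT.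
    + by move=> ->; exists x => // b; rewrite /= inE => /eqP->; left.
    have [xy|xy|yx] := tot x y.
    + exists y => // b; rewrite /= inE => /orP[/eqP->|/ly//].
      by right; exists x.
    + exists y => // b; rewrite /= inE => /orP[/eqP->|/ly//].
      by left; rewrite -zx xy.
    + exists x => // b; rewrite /= inE => /orP[/eqP->|/ly]; first by left.
      move=> [->|[t ty <-]]; right; first by exists y.
      by exists t => //; apply: tr ty yx.
- by exists k.
exact: (cA x Ax l lx k).
Qed.

Definition generated (S : set (set nat)) : set_system nat :=
  [set a | exists l k, [set` l] `<=` S /\
     forall m, (k <= m)%N -> inter l m -> a m].

Lemma generated_proper S : centered S -> ProperFilter (generated S).
Proof.
move=> cS; apply: Build_ProperFilter_ex.
  move=> a [l [k [lS la]]]; have [m km lm] := cS l lS k.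
  by exists m; apply: la.
split.
- by exists [::], 0.
- move=> a1 a2 [l1 [k1 [lS1 la1]]] [l2 [k2 [lS2 la2]]].
  exists (l1 ++ l2), (maxn k1 k2); split.
    by move=> a /=; rewrite mem_cat => /orP[/lS1|/lS2].
  move=> m; rewrite geq_max => /andP[k1m k2m] /inter_cat[l1m l2m].
  by split; [apply: la1|apply: la2].
- move=> a1 a2 a12 [l [k [lS la]]]; exists l, k; split=> // m km lm.
  by apply: a12; apply: la.
Qed.

Lemma generated_almost_superset S w a :
  S w -> almost_subset w a -> generated S a.
Proof.
move=> Sw /finite_set_nat_bound[k kP]; exists [:: w], k; split.
  by move=> b; rewrite /= inE => /eqP->.
move=> m km /(_ w (mem_head _ _)) wm; apply: contrapT => nam.
by have := kP m (conj wm nam); rewrite ltnNge km.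
Qed.

Lemma generated_tail S k : generated S [set i | (k <= i)%N].
Proof. by exists [::], k. Qed.

(** The constant task [A] puts [A] or its complement in the filter; the task
    that enumerates a countable [C] included in the filter can be settled only
    by a pseudointersection of [C]. *)
Lemma P_point_of_settling (S : set (set nat)) :
  centered S -> (forall y, exists2 w, S w & settles w y) ->
  P_point (generated S).
Proof.
move=> cS Sset; set U := generated S.
have PU : ProperFilter U := generated_proper cS.
have FU : Filter U by typeclasses eauto.
have SU w : S w -> U w.
  move=> Sw; apply: (generated_almost_superset Sw).
  by rewrite /almost_subset setDv.
split; [split|].
- split=> // G PG UG; apply/seteqP; split=> // A GA.
  have FG : Filter G by typeclasses eauto.
  have [w Sw [wA|[n wA]]] := Sset (fun=> A).
    exact: generated_almost_superset Sw (wA 0).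
  exfalso; apply: (@filter_not_empty _ G _).
  rewrite -wA; apply: filterI; first exact/UG/SU.
  by apply: filterS GA => m Am j _.
- move=> n /(congr1 (fun F : set_system nat => F [set i | (n.+1 <= i)%N])) E.
  have := generated_tail S n.+1; rewrite -/U E => /principal_filterP /=.
  by rewrite ltnn.
move=> C CU /countable_injP[f finj].
pose y n := xget setT [set A | C A /\ f A = n].
have Uy n : U (y n).
  by rewrite /y; case: xgetP => [A _ [/CU//]|_]; exact: filterT.
have yC A : C A -> y (f A) = A.
  move=> CA; rewrite /y; case: xgetP => [B _ [CB]|/(_ A) []//].
  by apply: finj; apply: mem_set.
have [w Sw [wy|[n wy]]] := Sset y.
  by exists w; [exact: SU|move=> A CA; rewrite -(yC A CA)].
exfalso; apply: (@filter_not_empty _ U _); rewrite -wy.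
apply: filterI; first exact: SU.
elim: n {wy} => [|n IH].
  by apply: filterS (Uy 0) => m ym j; rewrite leqn0 => /eqP->.
apply: filterS (filterI IH (Uy n.+1)) => m [ym ynm] j.
by rewrite leq_eqVlt => /orP[/eqP->//|/ym].
Qed.

Lemma MA_P_point : MA_countable -> exists U, P_point U.
Proof.
move=> MA; have [lt wo small] := exists_initial_wo (nat -> set nat).
have [wf _ _] := wo.
have [z zE] := wf_rec
  (fun y S => get [set w | centered (w |` S) /\ settles w y]) wf.
have step x : centered (z @` below lt x) ->
    centered (z x |` z @` below lt x) /\ settles (z x) x.
  move=> cx; rewrite zE.
  have [|w cw wx] := settle x MA _ cx.
    apply: card_lt_le (card_seq_image _ _) _.
    exact: card_lt_seq_below.
  pose good := [set w | centered (w |` z @` below lt x) /\ settles w x].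
  by apply: (@getPex _ good); exists w.
have cbelow x : centered (z @` below lt x).
  elim/(well_founded_ind wf): x => x IH.
  by apply: (centered_chain wo) => y /IH/step[].
exists (generated (range z)); apply: P_point_of_settling.
  by apply: (centered_chain wo) => x _; have [] := step _ (cbelow x).
by move=> y; exists (z y) => //; have [] := step _ (cbelow y).
Qed.

Theorem theorem40 : MA_countable ->
  exists U : set_system nat,
    P_point U /\ completely_baire (set_type (in_cantor U)).
Proof.
move=> /MA_P_point[U PU]; exists U; split=> //.
exact: P_point_completely_baire.
Qed.
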